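(* Let $ABC$ be a (non-degenerate) triangle in the Euclidean plane. Let $D$ and $K$ be arbitrary points on side $BC$, $E$ and $L$ arbitrary points on side $AC$, and $F$ and $M$ arbitrary points on side $AB$, all different from the vertices $A,B,C$. Denote $AK\cap EF=N$, $BL\cap DF=Q$, $CM\cap DE=P$, $DN\cap EQ=R$, $FP\cap EQ=S$, and $FP\cap DN=T$. Denote also $\frac{|BD|}{|DC|}=\lambda_1$, $\frac{|CE|}{|EA|}=\lambda_2$, $\frac{|AF|}{|FB|}=\lambda_3$, $\frac{|BK|}{|KC|}=u$, $\frac{|CL|}{|LA|}=v$, and $\frac{|AM|}{|MB|}=w$. Then $$\frac{\mathrm{Area}(\triangle RST)}{\mathrm{Area}(\triangle DEF)}\le\frac{(\lambda_1 \lambda_2 \lambda_3uvw-1)^2}{\left(\sqrt[3]{(\lambda_1 \lambda_2\lambda_3uvw)^2}+\sqrt[3]{\lambda_1 \lambda_2\lambda_3uvw}+1\right)^3}.$$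
   Context: $XY\cap ZW$ denotes the intersection point of the lines $XY$ and $ZW$, and $|XY|$ the length of segment $XY$. $\mathrm{Area}$ denotes the (unsigned) area of a triangle; a triangle whose vertices coincide or are collinear has area $0$. *)

(* Defs.v *)
From HB Require Import structures.
From mathcomp Require Import all_boot all_order all_algebra.
From mathcomp Require Import all_classical all_reals all_analysis.

Set Implicit Arguments.
Unset Strict Implicit.
Unset Printing Implicit Defensive.

Import Order.TTheory GRing.Theory Num.Theory.
Local Open Scope classical_set_scope.
Local Open Scope ring_scope.

(* The Euclidean plane over a realType RR is 'rV[RR]_2. *)

(* The library norm on 'rV is the sup norm, hence this explicit distance. *)
Definition dist (RR : realType) (X Y : 'rV[RR]_2) : RR :=
  Num.sqrt (\sum_(i < 2) (Y 0 i - X 0 i) ^+ 2).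

(* For X = Y this is the singleton [set X], not a line. *)
Definition line (RR : realType) (X Y : 'rV[RR]_2) : set 'rV[RR]_2 :=
  [set X + t *: (Y - X) | t in [set: RR]].

Definition segment (RR : realType) (X Y : 'rV[RR]_2) : set 'rV[RR]_2 :=
  [set X + t *: (Y - X) | t in [set t : RR | 0 <= t <= 1]].

Definition collinear (RR : realType) (X Y Z : 'rV[RR]_2) : Prop :=
  exists U V : 'rV[RR]_2,
    [/\ U <> V, line U V X, line U V Y & line U V Z].

(* The 2 x 2 matrix below has rows Y - X and Z - X. *)
Definition area (RR : realType) (X Y Z : 'rV[RR]_2) : RR :=
  `|\det (col_mx (Y - X) (Z - X) : 'M[RR]_2)| / 2.

(* A genuine cube root only for 0 <= x: powR sends every negative base to 1. *)
Definition cbrt (RR : realType) (x : RR) : RR := x `^ (3^-1).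

(* Main.v *)
(* Each of the lines AK, BL, CM cuts a side of DEF. Writing FN/NE = x, DQ/QF = y
   and EP/PD = z, one finds x = u l3 (1 + l2) / (1 + l3) and its cyclic analogues,
   so the factors 1 + l_i cancel in xyz = l1 l2 l3 u v w. Routh's theorem in DEF gives
   Area(RST)/Area(DEF) = (xyz - 1)^2 / ((1 + y + xy)(1 + z + yz)(1 + x + zx)).
   Hoelder's inequality, obtained by applying AM-GM to the terms of equal degree in the
   expanded denominator, bounds it below by (a^2 + a + 1)^3 where a^3 = xyz. *)
Require Import Defs.
From HB Require Import structures.
From mathcomp Require Import all_boot all_order all_algebra.
From mathcomp Require Import all_classical all_reals all_analysis.
From mathcomp Require Import ring lra.

Set Implicit Arguments.
Unset Strict Implicit.
Unset Printing Implicit Defensive.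

Import Order.TTheory GRing.Theory Num.Theory.
Local Open Scope classical_set_scope.
Local Open Scope ring_scope.

(** Twice the oriented area. Keeping the sign makes the area relations below identities of rational
    functions, within reach of [field]. *)
Definition cross (RR : realType) (X Y Z : 'rV[RR]_2) : RR :=
  (Y 0 0 - X 0 0) * (Z 0 1 - X 0 1) - (Y 0 1 - X 0 1) * (Z 0 0 - X 0 0).

Lemma areaE (RR : realType) (X Y Z : 'rV[RR]_2) :
  area X Y Z = `|cross X Y Z| / 2.
Proof.
rewrite /area /cross.
set M := (col_mx (Y - X) (Z - X) : 'M[RR]_2).
have M0 j : M 0 j = Y 0 j - X 0 j.
  have -> : (0 : 'I_2) = lshift 1 (0 : 'I_1) by apply/val_inj.
  by rewrite /M (@col_mxEu RR 1 1 2) !mxE.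
have M1 j : M 1 j = Z 0 j - X 0 j.
  have -> : (1 : 'I_2) = rshift 1 (0 : 'I_1) by apply/val_inj.
  by rewrite /M (@col_mxEd RR 1 1 2) !mxE.
move: M M0 M1 => M M0 M1.
have l0 : lift (0 : 'I_2) (0 : 'I_1) = 1 by apply/val_inj.
have l1 : lift (1 : 'I_2) (0 : 'I_1) = 0 by apply/val_inj.
rewrite (expand_det_row M (0 : 'I_2)) big_ord_recl big_ord1 /cofactor !det_mx11 !mxE.
rewrite !l0 !l1 !M0 !M1 /= expr0 expr1.
by congr (`|_| / _); ring.
Qed.

(** [collinear] asks for a line through two distinct points, so coincidences among [X], [Y], [Z] are
    treated apart. *)
Lemma cross_eq0_collinear (RR : realType) (X Y Z : 'rV[RR]_2) :
  cross X Y Z = 0 -> collinear X Y Z.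
Proof.
move=> c0.
have lineL (U V : 'rV[RR]_2) : line U V U by exists 0; rewrite ?scale0r ?addr0.
have lineR (U V : 'rV[RR]_2) : line U V V by exists 1; rewrite ?scale1r// addrC subrK.
have [->|XY] := eqVneq Y X.
  have [->|XZ] := eqVneq Z X.
    (* All three points coincide here, and any second point spans a suitable line. *)
    exists X, (X + const_mx 1); split => //.
    by move/rowP => /(_ 0); rewrite !mxE => h; lra.
  by exists X, Z; split => //; apply/eqP; rewrite eq_sym.
exists X, Y; split => //; first by apply/eqP; rewrite eq_sym.
have cE (i j : 'I_2) :
    (Y 0 i - X 0 i) * (Z 0 j - X 0 j) = (Y 0 j - X 0 j) * (Z 0 i - X 0 i).
  have c01 := subr0_eq c0.
  have ord2 (k : 'I_2) : k = 0 \/ k = 1.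
    by case: k => [[|[|//]]] ?; [left|right]; apply/val_inj.
  by have [->|->] := ord2 i; have [->|->] := ord2 j; rewrite // ?c01.
(* In a coordinate where [X] and [Y] differ, a quotient gives the parameter of [Z]; [cE] carries it
   over to the other coordinate. *)
have [i] : exists i, (Y - X) 0 i != 0 by apply/rV0Pn; rewrite subr_eq0.
rewrite !mxE => i0; exists ((Z 0 i - X 0 i) / (Y 0 i - X 0 i)) => //.
apply/rowP => j; rewrite !mxE mulrAC [_ * (Y 0 j - _)]mulrC -cE mulrAC divff//.
by rewrite mul1r addrC subrK.
Qed.


(** Cramer's rule. It allows coefficients to be compared in the affine frame with origin [X] and
    axes [Y - X], [Z - X]. *)
Lemma cross_indep (RR : realType) (X Y Z : 'rV[RR]_2) (a b : RR) :
  cross X Y Z != 0 -> a *: (Y - X) + b *: (Z - X) = 0 -> a = 0 /\ b = 0.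
Proof.
move=> d0 /rowP h; have := h 0; have := h 1; rewrite !mxE => h1 h0.
split; apply: (mulIf d0); rewrite mul0r /cross.
  transitivity ((a * (Y 0 0 - X 0 0) + b * (Z 0 0 - X 0 0)) * (Z 0 1 - X 0 1)
    - (a * (Y 0 1 - X 0 1) + b * (Z 0 1 - X 0 1)) * (Z 0 0 - X 0 0)); first by ring.
  by rewrite h0 h1; ring.
transitivity ((a * (Y 0 1 - X 0 1) + b * (Z 0 1 - X 0 1)) * (Y 0 0 - X 0 0)
    - (a * (Y 0 0 - X 0 0) + b * (Z 0 0 - X 0 0)) * (Y 0 1 - X 0 1)); first by ring.
by rewrite h0 h1; ring.
Qed.

(* The point [Z] of the line [X Y] with [XZ : ZY = r], so [r] is the weight of [Y]. *)
Definition divide (RR : realType) (r : RR) (X Y : 'rV[RR]_2) : 'rV[RR]_2 :=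
  (1 + r)^-1 *: (X + r *: Y).

Lemma segment_sym (RR : realType) (X Y Z : 'rV[RR]_2) :
  segment X Y Z -> segment Y X Z.
Proof.
move=> [t /= /andP[t0 t1] <-]; exists (1 - t) => /=.
  by apply/andP; split; lra.
by apply/rowP => i; rewrite !mxE; ring.
Qed.

Lemma line_sym (RR : realType) (X Y Z : 'rV[RR]_2) : line X Y Z -> line Y X Z.
Proof.
move=> [t _ <-]; exists (1 - t) => //.
by apply/rowP => i; rewrite !mxE; ring.
Qed.

Lemma dist_translate (RR : realType) (X Y V : 'rV[RR]_2) (t : RR) : 0 <= t ->
  Y - X = t *: V -> dist X Y = t * Num.sqrt (\sum_(i < 2) V 0 i ^+ 2).
Proof.
move=> t0 /rowP h; rewrite /dist.
rewrite (eq_bigr (fun i => t ^+ 2 * V 0 i ^+ 2)) => [|i _]; last first.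
  by have := h i; rewrite !mxE => ->; rewrite exprMn.
by rewrite -mulr_sumr sqrtrM ?sqr_ge0// sqrtr_sqr ger0_norm.
Qed.

Lemma segment_divide (RR : realType) (X Y Z : 'rV[RR]_2) :
  segment X Y Z -> Z != X -> Z != Y ->
  0 < dist X Z / dist Z Y /\ Z = divide (dist X Z / dist Z Y) X Y.
Proof.
move=> [t /= /andP[t0 t1] <-] ZX ZY.
have tp : 0 < t.
  rewrite lt_def t0 andbT; apply: contraNneq ZX => ->.
  by rewrite scale0r addr0.
have t1' : 0 < 1 - t.
  rewrite subr_gt0 lt_def t1 andbT; apply: contraNneq ZY => <-.
  by rewrite scale1r addrC subrK.
(* If [X = Y], then [Z] would be [X]. So the length of [Y - X] is nonzero and cancels in the ratio,
   leaving [t / (1 - t)]. *)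
have n0 : Num.sqrt (\sum_(i < 2) (Y - X) 0 i ^+ 2) != 0.
  rewrite sqrtr_eq0 -ltNge lt_def sumr_ge0 ?andbT => [|i _]; last exact: sqr_ge0.
  apply: contraNneq ZX => /eqP; rewrite psumr_eq0 => [/allP h|i _]; last exact: sqr_ge0.
  suff -> : Y - X = 0 by rewrite scaler0 addr0.
  apply/rowP => i; have /= := h i (mem_index_enum _).
  by rewrite sqrf_eq0 => /eqP ->; rewrite mxE.
have -> : dist X (X + t *: (Y - X)) / dist (X + t *: (Y - X)) Y = t / (1 - t).
  rewrite (@dist_translate _ X _ (Y - X) t) //; last by rewrite addrC addKr.
  rewrite (@dist_translate _ _ Y (Y - X) (1 - t)) //; first by field; rewrite n0 gt_eqF.
    exact: ltW.
  by apply/rowP => i; rewrite !mxE; ring.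
split; first exact: divr_gt0.
by apply/rowP => i; rewrite /divide !mxE; field; rewrite subrK oner_eq0 gt_eqF.
Qed.

(** Stated for the line from [A]; the cases of [B] and [C] follow by cyclic relabelling. *)
Lemma transversal_meet (RR : realType) (A B C N : 'rV[RR]_2) (l2 l3 u : RR) :
  cross A B C != 0 -> 0 < l2 -> 0 < l3 -> 0 < u ->
  line A (divide u B C) N -> line (divide l2 C A) (divide l3 A B) N ->
  N = divide (u * l3 * (1 + l2) / (1 + l3)) (divide l3 A B) (divide l2 C A).
Proof.
move=> d0 l20 l30 u0 [t _ ht] [s _ hs].
(* Coefficients of [B - A] and [C - A] in the difference of the two parametrisations of [N]. *)
have [] := @cross_indep _ A B C (t / (1 + u) - s * l3 / (1 + l3))
   (t * u / (1 + u) - (1 - s) / (1 + l2)) d0.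
  have := hs; rewrite -{}ht => /rowP h; apply/rowP => i; have := h i; rewrite /divide !mxE => hi.
  move/eqP: hi; rewrite -subr_eq0 => /eqP hi.
  rewrite -[RHS]oppr0 -hi; field; rewrite !gt_eqF//; lra.
move=> h1 h2.
(* Eliminating [t] by [h1] turns [h2] into a linear equation in [s], the weight of [divide l3 A B]
   in [N]. *)
have hts : s * (u * l3 * (1 + l2) + (1 + l3)) = 1 + l3.
  have e : t / (1 + u) = s * l3 / (1 + l3) by lra.
  move: h2; rewrite mulrAC e => h2.
  have : (1 + l3) * (1 + l2) * (s * l3 / (1 + l3) * u - (1 - s) / (1 + l2)) = 0.
    by rewrite h2 mulr0.
  have -> : (1 + l3) * (1 + l2) * (s * l3 / (1 + l3) * u - (1 - s) / (1 + l2))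
     = s * (u * l3 * (1 + l2) + (1 + l3)) - (1 + l3).
    by field; rewrite !gt_eqF//; lra.
  by move/eqP; rewrite subr_eq0 => /eqP.
have dp : 0 < u * l3 * (1 + l2) + (1 + l3).
  by rewrite ltr_wpDl ?mulr_ge0//; lra.
have sE : s = (1 + l3) / (u * l3 * (1 + l2) + (1 + l3)).
  by apply/(mulIf (lt0r_neq0 dp)); rewrite hts divfK ?gt_eqF.
rewrite -hs {}sE; apply/rowP => i; rewrite /divide !mxE; field.
by rewrite addrAC -addrA addrC !gt_eqF//; lra.
Qed.

(** Masses [1], [x * y], [y] at [D], [E], [F] have their centre on both cevians: [F] and [E] are
    weighted as [1 : x], and [D] and [F] as [1 : y]. *)
Lemma cevian_meet (RR : realType) (D E F X : 'rV[RR]_2) (x y : RR) :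
  cross D E F != 0 -> 0 < x -> 0 < y ->
  line D (divide x F E) X -> line E (divide y D F) X ->
  X = (1 + y + x * y)^-1 *: (D + (x * y) *: E + y *: F).
Proof.
move=> d0 x0 y0 [t _ ht] [s _ hs].
have xy0 : 0 < x * y by exact: mulr_gt0.
have [] := @cross_indep _ D E F (t * x / (1 + x) - (1 - s))
   (t / (1 + x) - s * y / (1 + y)) d0.
  have := hs; rewrite -{}ht => /rowP h; apply/rowP => i; have := h i; rewrite /divide !mxE => hi.
  move/eqP: hi; rewrite -subr_eq0 => /eqP hi.
  rewrite -[RHS]oppr0 -hi; field; rewrite !gt_eqF//; lra.
move=> h1 h2.
have sE : s = (1 + y) / (1 + y + x * y).
  have e : t / (1 + x) = s * y / (1 + y) by lra.
  move: h1; rewrite mulrAC e => h1.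
  have dp : 0 < 1 + y + x * y by lra.
  apply/(mulIf (lt0r_neq0 dp)); rewrite divfK ?gt_eqF//.
  apply/eqP; rewrite -subr_eq0; apply/eqP.
  transitivity ((1 + y) * (s * y / (1 + y) * x - (1 - s))); last by rewrite h1 mulr0.
  by field; rewrite gt_eqF//; lra.
rewrite -hs {}sE; apply/rowP => i; rewrite /divide !mxE; field.
by rewrite !gt_eqF//; lra.
Qed.

(** Routh's theorem in signed form: [cevian_meet] in the three cyclic rotations of [D E F] gives the
    vertices. Concurrent cevians, [x * y * z = 1], are included. *)
Lemma cross_routh (RR : realType) (D E F R S T : 'rV[RR]_2) (x y z : RR) :
  cross D E F != 0 -> 0 < x -> 0 < y -> 0 < z ->
  let N := divide x F E in let Q := divide y D F in let P := divide z E D in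
  line D N R -> line E Q R -> line F P S -> line E Q S ->
  line F P T -> line D N T ->
  cross R S T = cross D E F * ((x * y * z - 1) ^+ 2 /
    ((1 + y + x * y) * (1 + z + y * z) * (1 + x + z * x))).
Proof.
move=> d0 x0 y0 z0 N Q P RN RQ SP SQ TP TN.
have rot (X Y Z : 'rV[RR]_2) : cross Y Z X = cross X Y Z by rewrite /cross; ring.
have d1 : cross E F D != 0 by rewrite rot.
have d2 : cross F D E != 0 by rewrite rot.
have [xy0 yz0 zx0] : [/\ 0 < x * y, 0 < y * z & 0 < z * x] by rewrite !mulr_gt0.
rewrite (cevian_meet d0 x0 y0 RN RQ) (cevian_meet d1 y0 z0 SQ SP) (cevian_meet d2 z0 x0 TP TN).
rewrite /cross !mxE; field.
by rewrite !gt_eqF//; lra.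
Qed.

(** The factor is positive, so [D E F] inherits non-degeneracy from [A B C]. *)
Lemma cross_divide (RR : realType) (A B C : 'rV[RR]_2) (l1 l2 l3 : RR) :
  0 < l1 -> 0 < l2 -> 0 < l3 ->
  cross (divide l1 B C) (divide l2 C A) (divide l3 A B) =
  cross A B C * ((1 + l1 * l2 * l3) / ((1 + l1) * (1 + l2) * (1 + l3))).
Proof.
move=> l10 l20 l30; rewrite /cross /divide !mxE; field.
by rewrite !gt_eqF//; lra.
Qed.

(* Uses [(a+b+c)^3 - 27abc = (a+b+c)/2 * sum (a-b)^2 + 3 * sum a(b-c)^2]. *)
Lemma AGM3 (R : realFieldType) (a b c m : R) : 0 <= a -> 0 <= b -> 0 <= c ->
  0 <= m -> a * b * c = m ^+ 3 -> 3 * m <= a + b + c.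
Proof.
move=> a0 b0 c0 m0 e.
rewrite -(@ler_pXn2r _ 3) ?nnegrE//; [|lra|lra].
rewrite exprMn -e.
have ab := mulr_ge0 a0 (sqr_ge0 (b - c)).
have bc := mulr_ge0 b0 (sqr_ge0 (c - a)).
have ca := mulr_ge0 c0 (sqr_ge0 (a - b)).
have s1 := mulr_ge0 (addr_ge0 (addr_ge0 a0 b0) c0) (sqr_ge0 (a - b)).
have s2 := mulr_ge0 (addr_ge0 (addr_ge0 a0 b0) c0) (sqr_ge0 (b - c)).
have s3 := mulr_ge0 (addr_ge0 (addr_ge0 a0 b0) c0) (sqr_ge0 (c - a)).
lra.
Qed.

Lemma routh_denom_ge (R : realFieldType) (x y z a : R) :
  0 <= x -> 0 <= y -> 0 <= z -> 0 <= a -> x * y * z = a ^+ 3 ->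
  (a ^+ 2 + a + 1) ^+ 3 <=
  (1 + y + x * y) * (1 + z + y * z) * (1 + x + z * x).
Proof.
move=> x0 y0 z0 a0 e.
have [xy0 yz0 zx0] : [/\ 0 <= x * y, 0 <= y * z & 0 <= z * x] by rewrite !mulr_ge0.
have e1 := AGM3 x0 y0 z0 a0 e.
have e2 : 3 * a ^+ 2 <= x * y + y * z + z * x.
  apply: AGM3; rewrite ?exprn_ge0// -exprM mulnC exprM -e; ring.
have e3 : 3 * a ^+ 3 <= y ^+ 2 * z + z ^+ 2 * x + x ^+ 2 * y.
  apply: AGM3; rewrite ?mulr_ge0 ?exprn_ge0//.
  by rewrite -[in RHS]e; ring.
(* The terms of degree 4 and 5 are [x * y * z] times those of degree 1 and 2, hence the factor
   [a ^+ 3]. *)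
have e4 := ler_wpM2l (exprn_ge0 3 a0) e1.
have e5 := ler_wpM2l (exprn_ge0 3 a0) e2.
(* Sorted by degree, the lower bounds have coefficients 1, 3, 6, 7, 6, 3, 1, which are those of
   [(a ^+ 2 + a + 1) ^+ 3]. *)
have -> : (1 + y + x * y) * (1 + z + y * z) * (1 + x + z * x) =
  1 + (x + y + z) + 2 * (x * y + y * z + z * x) + 4 * (x * y * z)
  + (y ^+ 2 * z + z ^+ 2 * x + x ^+ 2 * y) + 2 * (x * y * z * (x + y + z))
  + x * y * z * (x * y + y * z + z * x) + (x * y * z) ^+ 2 by ring.
rewrite e; lra.
Qed.

Lemma cbrtX3 (RR : realType) (p : RR) : 0 <= p -> cbrt p ^+ 3 = p.
Proof.
move=> p0; rewrite /cbrt -powR_mulrn ?powR_ge0// -powRrM mulVf ?powRr1//.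
Qed.

Theorem theorem2p1 (RR : realType)
  (A B C D E F K L M N P Q R S T : 'rV[RR]_2)
  (l1 l2 l3 u v w : RR)
  (hABC : ~ collinear A B C)
  (hD : segment B C D) (hK : segment B C K)
  (hE : segment A C E) (hL : segment A C L)
  (hF : segment A B F) (hM : segment A B M)
  (hvertex : forall X, X \in [:: D; E; F; K; L; M] -> X \notin [:: A; B; C])
  (hN : line A K `&` line E F = [set N])
  (hQ : line B L `&` line D F = [set Q])
  (hP : line C M `&` line D E = [set P])
  (hR : line D N `&` line E Q = [set R])
  (hS : line F P `&` line E Q = [set S])
  (hT : line F P `&` line D N = [set T])
  (hl1 : dist B D / dist D C = l1)
  (hl2 : dist C E / dist E A = l2)
  (hl3 : dist A F / dist F B = l3)
  (hu : dist B K / dist K C = u)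
  (hv : dist C L / dist L A = v)
  (hw : dist A M / dist M B = w) :
  area R S T / area D E F <=
    (l1 * l2 * l3 * u * v * w - 1) ^+ 2 /
    (cbrt ((l1 * l2 * l3 * u * v * w) ^+ 2)
       + cbrt (l1 * l2 * l3 * u * v * w) + 1) ^+ 3.
Proof.
have d0 : cross A B C != 0.
  by apply/eqP => /cross_eq0_collinear.
have vert X : X \in [:: D; E; F; K; L; M] -> [/\ X != A, X != B & X != C].
  by move/hvertex; rewrite !inE !negb_or => /and3P.
have [_ DB DC] : [/\ D != A, D != B & D != C] by apply: vert; rewrite !inE eqxx.
have [EA _ EC] : [/\ E != A, E != B & E != C] by apply: vert; rewrite !inE eqxx ?orbT.
have [FA FB _] : [/\ F != A, F != B & F != C] by apply: vert; rewrite !inE eqxx ?orbT.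
have [_ KB KC] : [/\ K != A, K != B & K != C] by apply: vert; rewrite !inE eqxx ?orbT.
have [LA _ LC] : [/\ L != A, L != B & L != C] by apply: vert; rewrite !inE eqxx ?orbT.
have [MA MB _] : [/\ M != A, M != B & M != C] by apply: vert; rewrite !inE eqxx ?orbT.
have [] := segment_divide hD DB DC; rewrite hl1 => l10 DE.
(* The ratios on this side are measured from [C], whereas the segment is given from [A]. *)
have [] := segment_divide (segment_sym hE) EC EA; rewrite hl2 => l20 EE.
have [] := segment_divide hF FA FB; rewrite hl3 => l30 FE.
have [] := segment_divide hK KB KC; rewrite hu => u0 KE.
have [] := segment_divide (segment_sym hL) LC LA; rewrite hv => v0 LE.
have [] := segment_divide hM MA MB; rewrite hw => w0 ME.
have mem (G H : set 'rV[RR]_2) X : G `&` H = [set X] -> G X /\ H X.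
  by move=> e; have : (G `&` H) X by rewrite e.
have [NK NE] := mem _ _ _ hN; have [QL QD] := mem _ _ _ hQ.
have [PM PD] := mem _ _ _ hP; have [RN RQ] := mem _ _ _ hR.
have [SP SQ] := mem _ _ _ hS; have [TP TN] := mem _ _ _ hT.
have rot (X Y Z : 'rV[RR]_2) : cross Y Z X = cross X Y Z by rewrite /cross; ring.
set x := u * l3 * (1 + l2) / (1 + l3).
set y := v * l1 * (1 + l3) / (1 + l1).
set z := w * l2 * (1 + l1) / (1 + l2).
have Nx : N = divide x F E.
  by move: NK NE; rewrite KE EE FE; apply: transversal_meet.
(* The cyclic shift takes the line [E F] to [F D], so the line [D F] is reversed first. *)
have Qy : Q = divide y D F.
  move: QL (line_sym QD); rewrite LE DE FE; apply: transversal_meet => //.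
  by rewrite rot.
have Pz : P = divide z E D.
  move: PM PD; rewrite ME DE EE; apply: transversal_meet => //.
  by rewrite -rot.
have [x0 y0 z0] : [/\ 0 < x, 0 < y & 0 < z].
  by rewrite !divr_gt0 ?mulr_gt0 ?addr_gt0.
have p0 : 0 < l1 * l2 * l3 * u * v * w by rewrite !mulr_gt0.
have dDEF : cross D E F != 0.
  rewrite DE EE FE cross_divide// mulf_neq0// gt_eqF//.
  by rewrite divr_gt0 ?mulr_gt0 ?addr_gt0 ?mulr_gt0.
subst N Q P.
have -> : l1 * l2 * l3 * u * v * w = x * y * z.
  by rewrite /x /y /z; field; rewrite !gt_eqF//; lra.
clearbody x y z.
set p := x * y * z.
have {}p0 : 0 < p by rewrite /p !mulr_gt0.
have a0 : 0 < cbrt p by exact: powR_gt0.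
have -> : cbrt (p ^+ 2) = cbrt p ^+ 2.
  by rewrite !expr2 /cbrt powRM// ltW.
rewrite !areaE (cross_routh dDEF x0 y0 z0 RN RQ SP SQ TP TN) normrM.
have q0 : 0 < (1 + y + x * y) * (1 + z + y * z) * (1 + x + z * x).
  by rewrite !mulr_gt0 ?addr_gt0 ?mulr_gt0.
(* Routh's factor is nonnegative, so its absolute value drops. After the area of [D E F] cancels,
   both sides have the same numerator and only the denominators remain to be compared. *)
rewrite (ger0_norm (divr_ge0 _ (ltW q0))) ?sqr_ge0//.
rewrite [_ / 2]mulrAC mulrC mulKf; last by rewrite mulf_neq0 ?normr_eq0 ?invr_eq0 ?pnatr_eq0.
rewrite ler_wpM2l ?sqr_ge0// lef_pV2 ?posrE//; last by rewrite exprn_gt0 ?addr_gt0 ?exprn_gt0.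
by apply: routh_denom_ge; rewrite ?ltW// cbrtX3// ltW.
Qed.
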